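(* Let $(X,\Sigma_X,p)$ and $(Y,\Sigma_Y,q)$ be probability spaces. Every isomorphism mod zero between $(X,\Sigma_X,p)$ and $(Y,\Sigma_Y,q)$ induces an isomorphism $(X,\Sigma_X,p)\to(Y,\Sigma_Y,q)$ of $\mathsf{PS(Stoch)}$.
   Context: An isomorphism modulo zero between $(X,\Sigma_X,p)$ and $(Y,\Sigma_Y,q)$ is a measure-preserving isomorphism $f:(X',\Sigma_{X'},p')\to(Y',\Sigma_{Y'},q')$ (a measurable measure-preserving bijection with measurable measure-preserving inverse), where $X'\subseteq X$ and $Y'\subseteq Y$ are (measurable) subsets of measure one, with the induced $\sigma$-algebras and measures. A Markov kernel $k:X\to Y$ between measurable spaces assigns to $x\in X$ and measurable $B\subseteq Y$ a number $k(B|x)\in[0,1]$, being a probability measure in $B$ and measurable in $x$; composition is $(h\circ k)(C|x)=\int_Y h(C|y)\,k(dy|x)$, and identities are $(B,x)\mapsto 1_B(x)$. For a probability measure $p$ on $X$, kernels $f,g:X\to Y$ are $p$-almost surely equal if $\int_A f(B|x)\,p(dx)=\int_A g(B|x)\,p(dx)$ for all measurable $A\subseteq X$, $B\subseteq Y$. The category $\mathsf{PS(Stoch)}$ has probability spaces $(X,p)$ as objects; morphisms $(X,p)\to(Y,q)$ are $p$-a.s. equality classes of Markov kernels $f:X\to Y$ with $q(B)=\int_X f(B|x)\,p(dx)$ for all measurable $B\subseteq Y$. The morphism induced by an isomorphism mod zero $f:X'\to Y'$ is the $p$-a.s. equality class of any Markov kernel $k_f:X\to Y$ with $k_f(B|x)=1_{B}(f(x))$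 for all $x\in X'$ and $B\in\Sigma_Y$ (its values for $x\notin X'$ are immaterial). *)

(* Defs.v *)
From HB Require Import structures.
From mathcomp Require Import all_boot all_order all_algebra.
From mathcomp Require Import finmap.
From mathcomp Require Import all_classical all_reals all_analysis.
From mathcomp Require Import measurable_realfun.

Set Implicit Arguments.
Unset Strict Implicit.
Unset Printing Implicit Defensive.

Import Order.TTheory GRing.Theory Num.Theory.
Import numFieldNormedType.Exports.

Local Open Scope classical_set_scope.
Local Open Scope ring_scope.
Local Open Scope ereal_scope.
Local Open Scope quotient_scope.

Section isomorphism_mod_zero.
Context d d' (X : measurableType d) (Y : measurableType d') (R : realType).

(* The measurable subsets of D and E form their induced sigma-algebras, and the
   induced measures are the restrictions of p and q; the values of f outside D
   play no role. *)
Definition measure_preserving_on (p : probability X R) (D : set X)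
    (q : probability Y R) (E : set Y) (f : X -> Y) : Prop :=
  [/\ {homo f : x / D x >-> E x},
      measurable_fun D f &
      forall B, measurable B -> B `<=` E -> p (D `&` f @^-1` B) = q B].

End isomorphism_mod_zero.

(* X' = im0_dom and Y' = im0_cod. A map X' -> Y' is represented by a total
   function X -> Y, which is no restriction since measurable types are pointed. *)
Record iso_mod_zero d d' (X : measurableType d) (Y : measurableType d')
    (R : realType) (p : probability X R) (q : probability Y R) := IsoModZero {
  im0_dom : set X ;
  im0_cod : set Y ;
  im0_fun :> X -> Y ;
  im0_inv : Y -> X ;
  im0_dom_measurable : measurable im0_dom ;
  im0_cod_measurable : measurable im0_cod ;
  im0_dom1 : p im0_dom = 1 ;
  im0_cod1 : q im0_cod = 1 ;
  im0_fun_mp : measure_preserving_on p im0_dom q im0_cod im0_fun ;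
  im0_inv_mp : measure_preserving_on q im0_cod p im0_dom im0_inv ;
  im0_funK : forall x, im0_dom x -> im0_inv (im0_fun x) = x ;
  im0_invK : forall y, im0_cod y -> im0_fun (im0_inv y) = y }.

Section markov_kernels.
Context d d' (X : measurableType d) (Y : measurableType d') (R : realType).
Implicit Types (p : probability X R) (q : probability Y R).

Definition as_equal p (f g : R.-pker X ~> Y) : Prop :=
  forall A B, measurable A -> measurable B ->
    \int[p]_(x in A) f x B = \int[p]_(x in A) g x B.

Definition preserves p q (f : R.-pker X ~> Y) : Prop :=
  forall B, measurable B -> q B = \int[p]_x f x B.

End markov_kernels.

(* mkcomp_noparam takes its arguments in diagrammatic order: mkcomp_noparam k1 k2
   is the composite of k1 followed by k2. *)
Section composition_is_markov.
Context d0 d1 d2 (T0 : measurableType d0) (T1 : measurableType d1)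
  (T2 : measurableType d2) (R : realType).
Variables (k1 : R.-pker T0 ~> T1) (k2 : R.-pker T1 ~> T2).

Let prob_mkcomp x : mkcomp_noparam k1 k2 x [set: T2] = 1.
Proof.
rewrite /mkcomp_noparam /= /kcomp_noparam.
under eq_integral do rewrite prob_kernel.
by rewrite integral_cst// mul1e prob_kernel.
Qed.

HB.instance Definition _ := isProbabilityKernel.Build _ _ _ _ R
  (mkcomp_noparam k1 k2) prob_mkcomp.

End composition_is_markov.

Section kernel_lemmas.
Context d0 d1 (T0 : measurableType d0) (T1 : measurableType d1) (R : realType).

Lemma measurable_int_kernel (k : R.-pker T0 ~> T1) (h : T1 -> \bar R) :
  (forall y, 0 <= h y) -> measurable_fun setT h ->
  measurable_fun setT (fun x => \int[k x]_y h y).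
Proof.
move=> h0 mh.
apply: (measurable_fun_integral_finite_kernel (h \o snd) k) => //=.
exact: measurableT_comp.
Qed.

Lemma integral_preserves (p : probability T0 R) (q : probability T1 R)
    (k : R.-pker T0 ~> T1) (h : T1 -> \bar R) : preserves p q k ->
  (forall y, 0 <= h y) -> measurable_fun setT h ->
  \int[p]_x \int[k x]_y h y = \int[q]_y h y.
Proof.
move=> pq h0 mh.
pose P : unit -> pprobability T0 R := cst p.
have mP : measurable_fun setT P by exact: measurable_cst.
have := integral_kcomp (kprobability mP)
  (kernel.kernel_snd (T0 := unit) k) tt h0 mh.
rewrite /kernel.kernel_snd /= => <-.
by apply: eq_measure_integral => A mA _; rewrite /kcomp/= /kprobability/= pq.
Qed.

Lemma as_equal_ae (p : probability T0 R) (f g : R.-pker T0 ~> T1) :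
  as_equal p f g -> forall B, measurable B -> {ae p, forall x, f x B = g x B}.
Proof.
move=> fg B mB.
have : ae_eq p setT (f ^~ B) (g ^~ B).
  apply: integral_ae_eq => //.
  - apply: (@le_integrable _ _ _ p _ measurableT _ (cst 1)) => //.
    + exact: measurable_kernel.
    + move=> x _ /=; rewrite gee0_abs// normr1.
      by rewrite -(@prob_kernel _ _ _ _ _ f x) le_measure// inE.
    + by apply/integrableP; split => //; rewrite integral_cst//=
        probability_setT normr1 mule1 ltry.
  - exact: measurable_kernel.
  - by move=> E _ mE; exact: fg.
by apply: filterS => x /(_ I).
Qed.

Lemma ae_as_equal (p : probability T0 R) (f g : R.-pker T0 ~> T1) :
  (forall B, measurable B -> {ae p, forall x, f x B = g x B}) -> as_equal p f g.
Proof.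
move=> fg A B mA mB; apply: ae_eq_integral => //.
- by apply: (measurable_funS measurableT) => //; exact: measurable_kernel.
- by apply: (measurable_funS measurableT) => //; exact: measurable_kernel.
- by apply: filterS (fg _ mB) => x ->.
Qed.

Lemma as_equal_refl (p : probability T0 R) (f : R.-pker T0 ~> T1) :
  as_equal p f f.
Proof. by []. Qed.

Lemma as_equal_sym (p : probability T0 R) (f g : R.-pker T0 ~> T1) :
  as_equal p f g -> as_equal p g f.
Proof. by move=> fg A B mA mB; rewrite fg. Qed.

Lemma as_equal_trans (p : probability T0 R) (g f h : R.-pker T0 ~> T1) :
  as_equal p f g -> as_equal p g h -> as_equal p f h.
Proof. by move=> fg gh A B mA mB; rewrite fg// gh. Qed.

Import HBNNSimple.

Lemma as_equal_integral (p : probability T0 R) (f g : R.-pker T0 ~> T1)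
    (h : T1 -> \bar R) : as_equal p f g ->
  (forall y, 0 <= h y) -> measurable_fun setT h ->
  {ae p, forall x, \int[f x]_y h y = \int[g x]_y h y}.
Proof.
move=> fg h0 mh; pose h_ := nnsfun_approx measurableT mh.
have lim_h (m : {measure set T1 -> \bar R}) :
    \int[m]_y h y = limn (fun n => \int[m]_y (h_ n y)%:E).
  rewrite -monotone_convergence//=.
  - apply: eq_integral => y _; apply/esym/cvg_lim => //.
    by apply: cvg_nnsfun_approx.
  - by move=> n; exact/measurable_EFinP.
  - by move=> n y _; rewrite lee_fin.
  - by move=> y _ a b ab; rewrite lee_fin; exact/lefP/nd_nnsfun_approx.
have : {ae p, forall x, forall n,
    \int[f x]_y (h_ n y)%:E = \int[g x]_y (h_ n y)%:E}.
  apply: ae_foralln => n.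
  have : (almost_everywhere p) (\bigcap_(r in [set` fset_set (range (h_ n))])
      [set x | f x (h_ n @^-1` [set r]) = g x (h_ n @^-1` [set r])]).
    by apply: filter_bigI => r _; apply: as_equal_ae.
  apply: filterS => x /= hx.
  rewrite !integralT_nnsfun !sintegralE; apply: eq_fsbigr => r.
  rewrite inE => hr; congr (_ * _); apply: hx => /=.
  by rewrite in_fset_set// inE.
by apply: filterS => x hx; rewrite !lim_h; under eq_fun do rewrite hx.
Qed.

End kernel_lemmas.

Section composition_lemmas.
Context d0 d1 d2 (T0 : measurableType d0) (T1 : measurableType d1)
  (T2 : measurableType d2) (R : realType).
Variables (p : probability T0 R) (q : probability T1 R) (r : probability T2 R).

Lemma preserves_comp (f : R.-pker T0 ~> T1) (g : R.-pker T1 ~> T2) :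
  preserves p q f -> preserves q r g -> preserves p r (mkcomp_noparam f g).
Proof.
move=> pq qr C mC; rewrite qr// -(integral_preserves pq)//.
exact: measurable_kernel.
Qed.

Lemma as_equal_comp (f f' : R.-pker T0 ~> T1) (g g' : R.-pker T1 ~> T2) :
  preserves p q f -> as_equal p f f' -> as_equal q g g' ->
  as_equal p (mkcomp_noparam f g) (mkcomp_noparam f' g').
Proof.
move=> pq ff' gg'; apply: ae_as_equal => C mC.
have [N [mN N0 subN]] := as_equal_ae gg' mC.
have fN : {ae p, forall x, f x N = 0}.
  have : ae_eq p setT (f ^~ N) (cst 0).
    apply/ae_eq_integral_abs => //; first exact: measurable_kernel.
    by rewrite -[RHS]N0 pq//; apply: eq_integral => x _; rewrite gee0_abs.
  by apply: filterS => x /(_ I).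
have ff'g : {ae p, forall x, \int[f x]_y g' y C = \int[f' x]_y g' y C}.
  by apply: as_equal_integral => //; exact: measurable_kernel.
apply: filterS2 fN ff'g => x fN e.
apply: etrans e; apply: ae_eq_integral => //; [exact: measurable_kernel|exact: measurable_kernel|].
exists N; split => // y /= yN; apply: subN => /= e; apply: yN => _.
exact: e.
Qed.

End composition_lemmas.

(* The objects of PS(Stoch) are the probabilities p, q; psstoch p q is its type
   of morphisms from p to q. *)
Section morphisms.
Context d d' (X : measurableType d) (Y : measurableType d') (R : realType).
Variables (p : probability X R) (q : probability Y R).

Record mpkernel := MPKernel {
  mpkernel_val :> R.-pker X ~> Y ;
  mpkernelP : preserves p q mpkernel_val }.

HB.instance Definition _ := gen_eqMixin mpkernel.
HB.instance Definition _ := gen_choiceMixin mpkernel.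

Definition as_equalb (f g : mpkernel) : bool := `[< as_equal p f g >].

Let as_equalb_refl : reflexive as_equalb.
Proof. by move=> f; apply/asboolP. Qed.

Let as_equalb_sym : symmetric as_equalb.
Proof. by move=> f g; apply/asboolP/asboolP; exact: as_equal_sym. Qed.

Let as_equalb_trans : transitive as_equalb.
Proof.
by move=> g f h /asboolP fg /asboolP gh; apply/asboolP; exact: as_equal_trans gh.
Qed.

Canonical as_equalb_equiv :=
  EquivRel as_equalb as_equalb_refl as_equalb_sym as_equalb_trans.

Definition psstoch := {eq_quot as_equalb}.

Definition psstoch_class (f : mpkernel) : psstoch := \pi_psstoch f.

Lemma psstoch_classP (f g : mpkernel) :
  psstoch_class f = psstoch_class g <-> as_equal p f g.
Proof. by split=> [/eqmodP /asboolP|fg]//; apply/eqmodP/asboolP. Qed.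

End morphisms.

Section category.
Context d0 d1 d2 (T0 : measurableType d0) (T1 : measurableType d1)
  (T2 : measurableType d2) (R : realType).
Variables (p : probability T0 R) (q : probability T1 R) (r : probability T2 R).

Definition mpcomp (g : mpkernel q r) (f : mpkernel p q) : mpkernel p r :=
  MPKernel (preserves_comp (mpkernelP f) (mpkernelP g)).

(* The composite G after F; it does not depend on the representatives chosen by
   repr, see psstoch_compE. *)
Definition psstoch_comp (G : psstoch q r) (F : psstoch p q) : psstoch p r :=
  psstoch_class (mpcomp (repr G) (repr F)).

Lemma psstoch_compE (g : mpkernel q r) (f : mpkernel p q) :
  psstoch_comp (psstoch_class g) (psstoch_class f) = psstoch_class (mpcomp g f).
Proof.
apply/psstoch_classP; apply: (@as_equal_comp _ _ _ _ _ _ _ p q).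
- exact: mpkernelP.
- by apply/psstoch_classP; rewrite /psstoch_class reprK.
- by apply/psstoch_classP; rewrite /psstoch_class reprK.
Qed.

End category.

Section identity.
Context d (X : measurableType d) (R : realType) (p : probability X R).

Definition idker : R.-pker X ~> X := kdirac (@measurable_id _ X setT).

Lemma preserves_id : preserves p p idker.
Proof.
move=> B mB; rewrite -[in LHS](setIT B) -integral_indic//.
Qed.

Definition psstoch_id : psstoch p p := psstoch_class (MPKernel preserves_id).

End identity.

Section category_laws.
Context d0 d1 d2 d3 (T0 : measurableType d0) (T1 : measurableType d1)
  (T2 : measurableType d2) (T3 : measurableType d3) (R : realType).
Variables (p : probability T0 R) (q : probability T1 R)
  (r : probability T2 R) (s : probability T3 R).

Lemma psstoch_comp1f (F : psstoch p q) : psstoch_comp (psstoch_id q) F = F.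
Proof.
elim/quotW: F => f; rewrite psstoch_compE; apply/psstoch_classP.
apply: ae_as_equal => B mB; apply: aeW => x.
by rewrite /= /kcomp_noparam /= integral_indic// setIT.
Qed.

Lemma psstoch_compf1 (F : psstoch p q) : psstoch_comp F (psstoch_id p) = F.
Proof.
elim/quotW: F => f; rewrite psstoch_compE; apply/psstoch_classP.
apply: ae_as_equal => B mB; apply: aeW => x.
rewrite /= /kcomp_noparam /= integral_dirac//; last exact: measurable_kernel.
by rewrite diracT mul1e.
Qed.

Lemma psstoch_compA (H : psstoch r s) (G : psstoch q r) (F : psstoch p q) :
  psstoch_comp H (psstoch_comp G F) = psstoch_comp (psstoch_comp H G) F.
Proof.
elim/quotW: F => f; elim/quotW: G => g; elim/quotW: H => h.
rewrite -[\pi f]/(psstoch_class f) -[\pi g]/(psstoch_class g).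
rewrite -[\pi h]/(psstoch_class h).
rewrite (psstoch_compE g f) (psstoch_compE h (mpcomp g f)).
rewrite (psstoch_compE h g) (psstoch_compE (mpcomp h g) f); apply/psstoch_classP.
apply: ae_as_equal => B mB; apply: aeW => x.
have hB0 y : 0 <= h y B by exact: measure_ge0.
exact: (integral_kcomp f (kernel.kernel_snd (T0 := T0) g) x hB0
  (measurable_kernel h B mB)).
Qed.

End category_laws.

Section isomorphisms.
Context d d' (X : measurableType d) (Y : measurableType d') (R : realType).
Variables (p : probability X R) (q : probability Y R).

Definition psstoch_iso (F : psstoch p q) : Prop :=
  exists G : psstoch q p,
    psstoch_comp G F = psstoch_id p /\ psstoch_comp F G = psstoch_id q.

Definition kernel_of_iso (f : iso_mod_zero p q) (k : R.-pker X ~> Y) : Prop :=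
  forall x, im0_dom f x ->
  forall B, measurable B -> k x B = (\1_B (f x))%:E.

(* The class of any k with kernel_of_iso f k: such kernels exist, and all of
   them preserve the measures and lie in the class F. *)
Definition induced_by (f : iso_mod_zero p q) (F : psstoch p q) : Prop :=
  (exists k, kernel_of_iso f k) /\
  (forall k, kernel_of_iso f k ->
     exists pk : preserves p q k, F = psstoch_class (MPKernel pk)).

End isomorphisms.

(* Main.v *)
(* A kernel inducing f is the Dirac kernel of f almost everywhere.  A
   measurable total extension of f therefore provides one, all of them agree
   almost surely, and composing it with a kernel inducing the inverse of f gives
   almost everywhere the Dirac kernel of the identity. *)
Require Import Defs.
From mathcomp Require Import all_boot all_order all_algebra.
From mathcomp Require Import all_classical all_reals all_analysis.
From mathcomp Require Import measurable_realfun.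

Set Implicit Arguments.
Unset Strict Implicit.

Local Open Scope classical_set_scope.
Local Open Scope ring_scope.
Local Open Scope ereal_scope.

Lemma probability1_ae (R : realType) (d : measure_display)
    (X : measurableType d) (p : probability X R) (D : set X) :
  measurable D -> p D = 1 -> {ae p, forall x, D x}.
Proof.
move=> mD pD; exists (~` D); split => //; first exact: measurableC.
by rewrite probability_setC// pD subee.
Qed.

(** The part of [A] outside [D] lies in the null complement of [D]. *)
Lemma probability1_setI (R : realType) (d : measure_display)
    (X : measurableType d) (p : probability X R) (D A : set X) :
  measurable D -> p D = 1 -> measurable A -> p (A `&` D) = p A.
Proof.
move=> mD pD mA; have pDC : p (~` D) = 0 by rewrite probability_setC// pD subee.
rewrite [RHS](measureDI _ mA mD) [X in _ = X + _](_ : _ = 0) ?add0e//.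
apply: (@subset_measure0 _ _ _ _ _ (~` D)) => //; first exact: measurableD.
exact: measurableC.
Qed.

Section induced_kernels.
Variables (R : realType) (d d' : measure_display).
Variables (X : measurableType d) (Y : measurableType d').
Variables (p : probability X R) (q : probability Y R).
Implicit Types (f : iso_mod_zero p q) (k : R.-pker X ~> Y).

(** Lets every lemma about [f] be applied to its inverse as well. *)
Definition iso_mod_zero_sym f : iso_mod_zero q p :=
  IsoModZero (im0_cod_measurable f) (im0_dom_measurable f) (im0_cod1 f)
    (im0_dom1 f) (im0_inv_mp f) (im0_fun_mp f) (im0_invK (i:=f)) (im0_funK (i:=f)).

Lemma kernel_of_iso_exists f : exists k, kernel_of_iso f k.
Proof.
have [_ mf _] := im0_fun_mp f; have mD := im0_dom_measurable f.
(* The extension is constantly [point] off the domain, hence measurable because the domain is. *)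
have mg : measurable_fun setT (f \_ (im0_dom f)) by exact: (measurable_restrictT f mD).1 mf.
exists (kdirac mg) => x Dx B mB.
by rewrite /= /kdirac diracE indicE patchE (mem_set Dx).
Qed.

(** Almost everywhere [k x B] is the indicator of the part of the preimage of [B] in the domain, so
    its integral is the measure of that part. *)
Lemma kernel_of_iso_preserves f k : kernel_of_iso f k -> preserves p q k.
Proof.
move=> fk B mB; have [fDE mf pf] := im0_fun_mp f.
have mD := im0_dom_measurable f; have mE := im0_cod_measurable f.
have mfB : measurable (im0_dom f `&` f @^-1` B) by exact: mf.
transitivity (\int[p]_x (\1_(im0_dom f `&` f @^-1` B) x)%:E).
  (* Measure preservation speaks only of subsets of the codomain, so [B] is first cut down to it, at
     no cost in [q]-measure. *)
  rewrite integral_indic// setIT -(probability1_setI mE (im0_cod1 f) mB).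
  rewrite -pf//; last exact: measurableI.
  congr (p _); apply/seteqP; split => x /= [Dx]; first by case.
  by move=> Bfx; split => //; split => //; exact: fDE.
apply: ae_eq_integral => //; first exact/measurable_EFinP/measurable_indic.
  exact: measurable_kernel.
apply: filterS (probability1_ae mD (im0_dom1 f)) => x Dx _.
by rewrite fk// !indicE in_setI (mem_set Dx).
Qed.

Lemma kernel_of_iso_as_equal f k k' :
  kernel_of_iso f k -> kernel_of_iso f k' -> as_equal p k k'.
Proof.
move=> fk fk'; apply: ae_as_equal => B mB.
apply: filterS (probability1_ae (im0_dom_measurable f) (im0_dom1 f)) => x Dx.
by rewrite fk// fk'.
Qed.

Lemma kernel_of_iso_comp_inv f k (h : R.-pker Y ~> X) :
  kernel_of_iso f k -> kernel_of_iso (iso_mod_zero_sym f) h ->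
  as_equal p (mkcomp_noparam k h) (idker X R).
Proof.
move=> fk fh; apply: ae_as_equal => A mA.
apply: filterS (probability1_ae (im0_dom_measurable f) (im0_dom1 f)) => x Dx.
have [fDE _ _] := im0_fun_mp f.
(* Integrating against the Dirac measure at [f x] evaluates [h] at [f x], a point of the codomain,
   where [h] is Dirac at [im0_inv f (f x)], that is, at [x]. *)
rewrite /= /kcomp_noparam (@eq_measure_integral _ _ _ _ (\d_(f x)))/=; last first.
  by move=> B mB _; rewrite fk// diracE indicE.
rewrite integral_dirac//; last exact: measurable_kernel.
rewrite diracT mul1e fh//=; last exact: fDE.
by rewrite im0_funK// /kdirac diracE indicE.
Qed.

End induced_kernels.

Theorem proposition2p8 (R : realType) (d d' : measure_display)
    (X : measurableType d) (Y : measurableType d')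
    (p : probability X R) (q : probability Y R) (f : iso_mod_zero p q) :
  exists F : psstoch p q, induced_by f F /\ psstoch_iso F.
Proof.
have [k fk] := kernel_of_iso_exists f.
have [h fh] := kernel_of_iso_exists (iso_mod_zero_sym f).
pose K := MPKernel (kernel_of_iso_preserves fk).
pose H := MPKernel (kernel_of_iso_preserves fh).
exists (psstoch_class K); split.
  split=> [|k' fk']; first by exists k.
  exists (kernel_of_iso_preserves fk'); apply/psstoch_classP.
  exact: kernel_of_iso_as_equal fk fk'.
exists (psstoch_class H); split; rewrite psstoch_compE; apply/psstoch_classP.
  exact: kernel_of_iso_comp_inv fk fh.
(* Here [fk] serves for the twice reversed isomorphism, whose domain and map compute to those of
   [f]. *)
exact: kernel_of_iso_comp_inv fh fk.
Qed.
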